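(* Let $n\ge 1$ be an integer and let $$u=\sum_{\substack{i,j,k\in \mathbb{Z}/3\mathbb{Z}\\ i+j+k=0}} [i]\otimes[j]\otimes[k]\in \mathbb{F}_3^{3}\otimes \mathbb{F}_3^{3}\otimes\mathbb{F}_3^{3},$$ where $[0],[1],[2]$ is the standard basis of $\mathbb{F}_3^3$ indexed by $\mathbb{Z}/3\mathbb{Z}$. Let $u^{\boxtimes n}$ be its $n$-fold vertical (Kronecker) tensor power, a tensor in $\mathbb{F}_3^{3^n}\otimes \mathbb{F}_3^{3^n}\otimes\mathbb{F}_3^{3^n}$. Then $$r_3(\mathbb{F}_3^n)\le \operatorname{rk}^G(u^{\boxtimes n})\le \operatorname{srk}(u^{\boxtimes n}).$$
   Context: $r_3(\mathbb{F}_3^n)$ is the largest cardinality of a subset $S\subseteq \mathbb{F}_3^n$ containing no three distinct elements $x,y,z$ with $x+z=2y$. Vertical tensor product: for $v\in V_1\otimes\cdots\otimes V_d$ and $w\in W_1\otimes\cdots\otimes W_d$, $v\boxtimes w$ denotes the tensor product $v\otimes w$ viewed as an element of $(V_1\otimes W_1)\otimes\cdots\otimes(V_d\otimes W_d)$ (a tensor with $d$ factors); $u^{\boxtimes n}=u\boxtimes\cdots\boxtimes u$ ($n$ copies). Slice rank: a nonzero tensor in $V=V_1\otimes\cdots\otimes V_d$ has slice rank $1$ if it lies in $V_1\otimes\cdots\otimes V_{i-1}\otimes w\otimes V_{i+1}\otimes\cdots\otimes V_d$ for some $i$ and some $w\in V_i$. The slice rank $\operatorname{srk}(v)$ is the smallest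 $r\ge 0$ such that $v$ is a sum of $r$ tensors of slice rank $1$. $G$-stable rank: let $K$ be a perfect field (here $K=\mathbb{F}_3$), $V_1,\dots,V_d$ finite-dimensional $K$-vector spaces, $V=V_1\otimes\cdots\otimes V_d$. For a $K$-vector space $W$ and $v(t)\in K((t))\otimes W$, $\operatorname{val}_t(v(t))$ is the largest integer $m$ with $v(t)\in t^m(K[[t]]\otimes W)$, and $\operatorname{val}_t(0)=\infty$. Let $\mathrm{GL}(V_i,K[[t]])$ be the set of elements of $K[[t]]\otimes\operatorname{End}(V_i)$ that are invertible over $K((t))$ (the inverse need not have entries in $K[[t]]$), and $G(K[[t]])=\prod_{i}\mathrm{GL}(V_i,K[[t]])$, acting on $K((t))\otimes V$ factorwise. Then $\operatorname{rk}^G(v)$ is the infimum of $$\frac{\sum_{i=1}^d \operatorname{val}_t(\det g_i(t))}{\operatorname{val}_t(g(t)\cdot v)}$$ over all $g(t)=(g_1(t),\dots,g_d(t))\in G(K[[t]])$ with $\operatorname{val}_t(g(t)\cdot v)>0$ (a quotient with denominator $\infty$ is $0$). *)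

(* Defs.v *)
From HB Require Import structures.
From mathcomp Require Import all_boot all_order all_algebra.
From mathcomp Require Import boolp classical_sets reals ereal.

Set Implicit Arguments.
Unset Strict Implicit.
Unset Printing Implicit Defensive.

Import Order.TTheory GRing.Theory Num.Theory.

Local Open Scope ring_scope.

(** * Formal power series and Laurent series *)

Record fps (K : fieldType) : Type := Fps { fpscoef : nat -> K }.

HB.instance Definition _ (K : fieldType) := gen_eqMixin (fps K).
HB.instance Definition _ (K : fieldType) := gen_choiceMixin (fps K).

Lemma fpsP (K : fieldType) (f g : fps K) : fpscoef f =1 fpscoef g -> f = g.
Proof. by case: f g => [f] [g] /= /funext ->. Qed.

Definition fps_zero (K : fieldType) : fps K := Fps (fun _ => 0).
Definition fps_opp (K : fieldType) (f : fps K) : fps K :=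
  Fps (fun n => - fpscoef f n).
Definition fps_add (K : fieldType) (f g : fps K) : fps K :=
  Fps (fun n => fpscoef f n + fpscoef g n).
Definition fpsC (K : fieldType) (c : K) : fps K := Fps (fun n => c *+ (n == 0)%N).
Definition fps_mul (K : fieldType) (f g : fps K) : fps K :=
  Fps (fun n => \sum_(i < n.+1) fpscoef f i * fpscoef g (n - i)).
Definition fpsX (K : fieldType) : fps K := Fps (fun n => (n == 1)%N%:R).

Lemma fps_addA (K : fieldType) : associative (@fps_add K).
Proof. by move=> f g h; apply: fpsP => n /=; rewrite addrA. Qed.
Lemma fps_addC (K : fieldType) : commutative (@fps_add K).
Proof. by move=> f g; apply: fpsP => n /=; rewrite addrC. Qed.
Lemma fps_add0 (K : fieldType) : left_id (@fps_zero K) (@fps_add K).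
Proof. by move=> f; apply: fpsP => n /=; rewrite add0r. Qed.
Lemma fps_addN (K : fieldType) :
  left_inverse (@fps_zero K) (@fps_opp K) (@fps_add K).
Proof. by move=> f; apply: fpsP => n /=; rewrite addNr. Qed.

HB.instance Definition _ (K : fieldType) := GRing.isZmodule.Build (fps K)
  (@fps_addA K) (@fps_addC K) (@fps_add0 K) (@fps_addN K).

Definition fps_trunc (K : fieldType) (N : nat) (f : fps K) : {poly K} :=
  \poly_(i < N) fpscoef f i.

Lemma coef_fps_trunc (K : fieldType) N (f : fps K) i :
  (i < N)%N -> (fps_trunc N f)`_i = fpscoef f i.
Proof. by move=> iN; rewrite coef_poly iN. Qed.

Lemma fps_mul_trunc (K : fieldType) (f g : fps K) N n : (n < N)%N ->
  fpscoef (fps_mul f g) n = (fps_trunc N f * fps_trunc N g)`_n.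
Proof.
move=> nN; rewrite coefM /=; apply: eq_bigr => i _.
have iN : (i < N)%N by apply: leq_ltn_trans nN; rewrite -ltnS.
by rewrite !coef_fps_trunc // (leq_ltn_trans (leq_subr _ _) nN).
Qed.

Lemma fps_mulC (K : fieldType) : commutative (@fps_mul K).
Proof.
by move=> f g; apply: fpsP => n; rewrite !(fps_mul_trunc _ _ (ltnSn n)) mulrC.
Qed.

Lemma fps_mulA (K : fieldType) : associative (@fps_mul K).
Proof.
move=> f g h; apply: fpsP => n.
have E N (a b c : fps K) : (n < N)%N -> fpscoef (fps_mul a (fps_mul b c)) n =
    (fps_trunc N a * (fps_trunc N b * fps_trunc N c))`_n.
  move=> nN; rewrite (fps_mul_trunc _ _ nN).
  rewrite [LHS]coefM [RHS]coefM; apply: eq_bigr => i _; congr (_ * _).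
  have jN : (n - i < N)%N by rewrite (leq_ltn_trans (leq_subr _ _) nN).
  by rewrite coef_fps_trunc // (fps_mul_trunc _ _ jN).
rewrite (E n.+1) // (fps_mulC (fps_mul f g)) (E n.+1) //.
by rewrite mulrA mulrC.
Qed.

Lemma fps_mul1 (K : fieldType) : left_id (fpsC 1) (@fps_mul K).
Proof.
move=> f; apply: fpsP => n /=; rewrite big_ord_recl /= mul1r subn0 big1 ?addr0 //.
by move=> i _; rewrite /= mul0r.
Qed.

Lemma fps_mulD (K : fieldType) : left_distributive (@fps_mul K) +%R.
Proof.
move=> f g h; apply: fpsP => n /=; rewrite -big_split /=.
by apply: eq_bigr => i _; rewrite mulrDl.
Qed.

Lemma fps_oner_neq0 (K : fieldType) : fpsC 1 != 0 :> fps K.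
Proof.
by apply/eqP => /(congr1 (fun f => fpscoef f 0)) /eqP; rewrite /= oner_eq0.
Qed.

HB.instance Definition _ (K : fieldType) :=
  GRing.Zmodule_isComNzRing.Build (fps K)
    (@fps_mulA K) (@fps_mulC K) (@fps_mul1 K) (@fps_mulD K) (fps_oner_neq0 K).

Definition fps_unit (K : fieldType) : pred (fps K) :=
  fun f => `[< exists g : fps K, g * f = 1 >].

Definition fps_inv (K : fieldType) (f : fps K) : fps K :=
  if pselect (exists g : fps K, g * f = 1) is left h then projT1 (cid h) else f.

Lemma fps_mulVf (K : fieldType) :
  {in @fps_unit K, left_inverse 1 (@fps_inv K) *%R}.
Proof.
move=> f /asboolP fu; rewrite /fps_inv; case: pselect => // h.
by case: (cid h).
Qed.

Lemma fps_unitP (K : fieldType) (f g : fps K) : g * f = 1 -> fps_unit f.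
Proof. by move=> gf; apply/asboolP; exists g. Qed.

Lemma fps_inv_out (K : fieldType) : {in [predC @fps_unit K], @fps_inv K =1 id}.
Proof.
by move=> f /asboolP fu; rewrite /fps_inv; case: pselect.
Qed.

HB.instance Definition _ (K : fieldType) :=
  GRing.ComNzRing_hasMulInverse.Build (fps K)
    (@fps_mulVf K) (@fps_unitP K) (@fps_inv_out K).

Lemma fps_lowest (K : fieldType) (f : fps K) : f != 0 ->
  exists2 n, fpscoef f n != 0 & forall i, (i < n)%N -> fpscoef f i = 0.
Proof.
move=> f0; have exf : exists n, fpscoef f n != 0.
  apply: contrapT => nf; case/eqP: f0; apply: fpsP => n.
  by apply/eqP; apply/negPn/negP => fn; apply: nf; exists n.
exists (ex_minn exf); case: ex_minnP => // m _ mP i im.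
by apply/eqP; apply: contraTT im => /mP; rewrite leqNgt.
Qed.

Lemma fps_mulf_eq0 (K : fieldType) : GRing.integral_domain_axiom (fps K).
Proof.
move=> f g fg0; apply/norP => -[/fps_lowest[m fm fmin] /fps_lowest[n gn gmin]].
have /eqP := congr1 (fun h => fpscoef h (m + n)) fg0.
have mmn : (m < (m + n).+1)%N by rewrite ltnS leq_addr.
rewrite /= (bigD1 (Ordinal mmn)) //= addKn big1 ?addr0.
  by rewrite mulf_eq0 (negPf fm) (negPf gn).
move=> i; rewrite -val_eqE neq_ltn /= => /orP[im|im].
  by rewrite fmin ?mul0r.
rewrite gmin ?mulr0 // ltn_subLR; last by rewrite -ltnS.
by rewrite ltn_add2r.
Qed.

HB.instance Definition _ (K : fieldType) :=
  GRing.ComUnitRing_isIntegral.Build (fps K) (@fps_mulf_eq0 K).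

(* K((t)), as the field of fractions of K[[t]] *)
Notation laurent K := {fraction (fps K)}.

(* val_t of an element of K((t)) (x) W, given by its coordinates in a basis of W
   indexed by X. The supremum is a maximum unless v = 0, where it is +oo. *)
Definition valt (R : realType) (K : fieldType) (X : Type) (v : X -> laurent K) :
    \bar R :=
  ereal_sup [set (m%:~R)%:E | m in [set m : int |
    exists w : X -> fps K,
      forall x, v x = (tofrac (fpsX K)) ^ m * tofrac (w x)]]%classic.

(** * Tensors *)

(* A d-factor tensor, in coordinates: the i-th factor is the space with basis
   indexed by the finite type I i. *)
Notation tensor K I := {ffun {dffun forall i, I i} -> K}.

Definition pure_tensor (K : fieldType) (d : nat) (I : 'I_d -> finType)
    (w : forall i, I i -> K) : tensor K I :=
  [ffun x : {dffun forall i, I i} => \prod_i w i (x i)].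

(* The vertical product of u and v: the i-th factor is V_i (x) W_i, with basis
   indexed by I i * J i. *)
Definition vprod (K : fieldType) (d : nat) (I J : 'I_d -> finType)
    (u : tensor K I) (v : tensor K J) : tensor K (fun i => (I i * J i)%type) :=
  [ffun x : {dffun forall i, (I i * J i)%type} =>
    u [ffun i => (x i).1] * v [ffun i => (x i).2]].

(* The n-fold vertical power: the i-th factor is the n-th tensor power of V_i,
   with basis indexed by n-tuples of elements of I i. *)
Definition vpow (K : fieldType) (d : nat) (I : 'I_d -> finType) (n : nat)
    (u : tensor K I) : tensor K (fun i => {ffun 'I_n -> I i}) :=
  [ffun x : {dffun forall i, {ffun 'I_n -> I i}} =>
    \prod_(l < n) u [ffun i => x i l]].

(* vpow n is the n-fold iterate of vprod, up to the identification of
   (n+1)-tuples with pairs (head, tail). *)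
Lemma vpowS (K : fieldType) (d : nat) (I : 'I_d -> finType) (n : nat)
    (u : tensor K I) (x : {dffun forall i, {ffun 'I_n.+1 -> I i}}) :
  vpow n.+1 u x = vprod u (vpow n u)
    [ffun i => (x i ord0, [ffun l => x i (lift ord0 l)])].
Proof.
rewrite !ffunE big_ord_recl; congr (_ * _).
  by congr (u _); apply/ffunP => i; rewrite !ffunE.
apply: eq_bigr => l _; congr (u _); apply/ffunP => i.
by rewrite !ffunE.
Qed.

(** * Slice rank *)

(* s = w (x) s' with w in V_i and s' in the tensor product of the other factors;
   s' is encoded by a function of all coordinates that ignores the i-th one. *)
Definition slice (K : fieldType) (d : nat) (I : 'I_d -> finType) (i : 'I_d)
    (s : tensor K I) : Prop :=
  exists (w : I i -> K) (s' : tensor K I),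
    (forall x y : {dffun forall i, I i},
       (forall j, j != i -> x j = y j) -> s' x = s' y) /\
    (forall x : {dffun forall i, I i}, s x = w (x i) * s' x).

Definition slice_rank1 (K : fieldType) (d : nat) (I : 'I_d -> finType)
    (s : tensor K I) : Prop :=
  s != 0 /\ exists i, slice i s.

Definition slice_decomp (K : fieldType) (d : nat) (I : 'I_d -> finType)
    (v : tensor K I) (r : nat) : Prop :=
  exists s : 'I_r -> tensor K I,
    (forall k, slice_rank1 (s k)) /\ v = \sum_k s k.

Lemma slice_decomp_ex (K : fieldType) (d : nat) (I : 'I_d.+1 -> finType)
    (v : tensor K I) : exists r, `[< slice_decomp v r >].
Proof.
pose f (a : I ord0) : tensor K I :=
  [ffun x : {dffun forall i, I i} => (x ord0 == a)%:R * v x].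
have fslice a : slice ord0 (f a).
  pose put (x : {dffun forall i, I i}) : {dffun forall i, I i} :=
    [ffun i => if eqVneq i ord0 is EqNotNeq e then
       ecast j (I j) (esym e) a else x i].
  exists (fun b => (b == a)%:R), [ffun x => v (put x)]; split=> x.
    move=> y xy; rewrite !ffunE; congr (v _); apply/ffunP => i; rewrite !ffunE.
    by case: eqVneq => // /xy.
  rewrite !ffunE; case: eqVneq => [xa|]; rewrite ?mul0r // !mul1r.
  congr (v _); apply/ffunP => i; rewrite !ffunE; case: eqVneq => // e.
  by subst i; rewrite /= xa.
have vE : v = \sum_(a | f a != 0) f a.
  rewrite big_mkcond (eq_bigr f); last by move=> a _; case: eqP.
  apply/ffunP => x.
  rewrite sum_ffunE (bigD1 (x ord0)) //= ffunE eqxx mul1r big1 ?addr0 // => a ax.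
  by rewrite ffunE eq_sym (negPf ax) mul0r.
pose A := [pred a | f a != 0].
exists #|A|; apply/asboolP; exists (fun k => f (enum_val k)); split.
  move=> k; split; last by exists ord0.
  exact: (enum_valP k).
by rewrite {1}vE -(big_enum_val (A := A) f).
Qed.

Definition slice_rank (K : fieldType) (d : nat) (I : 'I_d.+1 -> finType)
    (v : tensor K I) : nat :=
  ex_minn (slice_decomp_ex v).

(** * G-stable rank *)

(* Factorwise action of a tuple of endomorphisms; the matrix of the i-th one is
   taken in the basis of the i-th factor, enumerated by enum_rank. *)
Definition tensor_act (L : fieldType) (d : nat) (I : 'I_d -> finType)
    (g : forall i, 'M[L]_#|I i|) (v : tensor L I) : tensor L I :=
  [ffun x : {dffun forall i, I i} =>
    \sum_(y : {dffun forall i, I i})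
      (\prod_i g i (enum_rank (x i)) (enum_rank (y i))) * v y].

Definition tensor_laurent (K : fieldType) (d : nat) (I : 'I_d -> finType)
    (v : tensor K I) : tensor (laurent K) I :=
  [ffun x => tofrac (fpsC (v x))].

(* The entries of g lie in K[[t]], but g is only required to be invertible over
   K((t)). In \bar R, x / +oo = 0, and the infimum of the empty set is +oo. *)
Definition G_stable_rank (R : realType) (K : fieldType) (d : nat)
    (I : 'I_d -> finType) (v : tensor K I) : \bar R :=
  ereal_inf [set q : \bar R | exists g : forall i, 'M[fps K]_#|I i|,
    let h i := map_mx (@tofrac (fps K)) (g i) : 'M[laurent K]_#|I i| in
    let den := valt R (tensor_act h (tensor_laurent v)) in
    [/\ forall i, h i \in unitmx,
        (0 < den)%E &
        q = ((\sum_i valt R (fun _ : unit => \det (h i))) / den)%E]]%classic.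

(** * The tensor u and three-term progressions *)

Definition basis_vec (I : finType) (a : I) : I -> 'F_3 := fun b => (b == a)%:R.

Definition zero_sum_tensor : tensor 'F_3 (fun _ : 'I_3 => 'Z_3 : finType) :=
  \sum_(i : 'Z_3) \sum_(j : 'Z_3) \sum_(k : 'Z_3 | i + j + k == 0)
    pure_tensor (tnth [tuple basis_vec i; basis_vec j; basis_vec k]).

Definition ap3_free (n : nat) (S : {set 'rV['F_3]_n}) : bool :=
  ~~ [exists x in S, exists y in S, exists z in S,
        [&& x != y, y != z, x != z & x + z == y *+ 2]].

Definition r3 (n : nat) : nat :=
  \max_(S : {set 'rV['F_3]_n} | ap3_free S) #|S|.

(* Main.v *)
Require Import Defs.
From HB Require Import structures.
From mathcomp Require Import all_boot all_order all_algebra all_fingroup.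
From mathcomp Require Import zify.
From mathcomp Require Import boolp classical_sets reals ereal.

Import Order.TTheory GRing.Theory Num.Theory.

Local Open Scope ring_scope.

Set Implicit Arguments.
Unset Strict Implicit.
Unset Printing Implicit Defensive.

(** The lower bound. On a set S without three-term progressions the tensor
    u^n restricts to a diagonal tensor, because x + y + z = 0 in characteristic 3
    means that x, y, z is a progression or a constant triple. So let v be a
    tensor with d >= 2 factors that is diagonal on S, and let g act with all
    entries of g.v divisible by t^m. Row operations over K[[t]] change neither
    this divisibility nor the valuations of the determinants, and they make each
    g_l triangular for any total order chosen on its basis
    (fps_row_reduction). Put S on top in every order, increasingly for all
    factors but the first, and decreasingly for the first one
    (opposite_orders). Then for a in S the entry of g.v at (a, ..., a) has only
    one nonzero term, namely the product of the diagonal entries of the g_l at a,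
    times v(a, ..., a); hence t^m divides that product. Multiplying over a in S,
    t^(m |S|) divides the product of the determinants (diagonal_det_dvd), so that
    |S| is at most the quotient attached to g (diagonal_le_G_stable_rank).

    The upper bound. Take a decomposition into r slices. Let g_i scale by t the
    span of the vectors that the slices of direction i put in the i-th factor,
    and fix a complement of it. Every slice gets multiplied by t, while the
    valuations of the determinants are the dimensions of these spans, of sum at
    most r (G_stable_rank_le_slices). *)

(** * Arithmetic of K[[t]] *)

Section PowerSeries.
Context {K : fieldType}.
Implicit Types (f g : fps K) (n : nat).

(** The first n coefficients of the inverse of f, the last one first: each
    coefficient is computed from all the previous ones. *)
Fixpoint fps_inv_coefs f n : seq K :=
  if n is m.+1 then
    (fpscoef f 0)^-1 *
      ((m == 0)%N%:R
       - \sum_(i < m) fpscoef f i.+1 * (fps_inv_coefs f m)`_i)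
    :: fps_inv_coefs f m
  else [::].

Lemma nth_fps_inv_coefs f n i : (i < n)%N ->
  (fps_inv_coefs f n)`_i = (fps_inv_coefs f (n - i))`_0.
Proof. by elim: n i => // n IHn [|i] // ltin; rewrite /= IHn. Qed.

Lemma fps_inv_rec f : exists b : nat -> K, forall n,
  b n = (fpscoef f 0)^-1 *
    ((n == 0)%N%:R - \sum_(i < n) fpscoef f i.+1 * b (n - i.+1)%N).
Proof.
exists (fun n => (fps_inv_coefs f n.+1)`_0) => n.
rewrite [LHS]/=; congr (_ * (_ - _)); apply: eq_bigr => i _.
by rewrite [in LHS]nth_fps_inv_coefs // subnSK.
Qed.

Lemma fps_unitE f : (f \is a GRing.unit) = (fpscoef f 0 != 0).
Proof.
apply/idP/idP => [/divrr/(congr1 (fun h => fpscoef h 0))/=|f0].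
  rewrite big_ord1 /= => fV; apply/eqP => f0; move/eqP: fV.
  by rewrite f0 mul0r eq_sym oner_eq0.
have [b bE] := fps_inv_rec f.
apply/unitrPr; exists (Fps b); apply: fpsP => n.
rewrite /= big_ord_recl /= subn0 {1}bE mulrA divff // mul1r.
by rewrite /bump /= subrK.
Qed.

Lemma fpsC_is_zmod_morphism : zmod_morphism (@fpsC K).
Proof. by move=> a b; apply: fpsP => n /=; rewrite mulrnBl. Qed.

Lemma fpsC_is_monoid_morphism : monoid_morphism (@fpsC K).
Proof.
split=> // a b; apply: fpsP => -[|n] /=; first by rewrite big_ord1.
rewrite big1 ?mulr0n // => -[[|i] lti] _ /=; first by rewrite mulr0.
by rewrite mul0r.
Qed.

HB.instance Definition _ := GRing.isZmodMorphism.Build K (fps K) (@fpsC K)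
  fpsC_is_zmod_morphism.
HB.instance Definition _ := GRing.isMonoidMorphism.Build K (fps K) (@fpsC K)
  fpsC_is_monoid_morphism.

Lemma fpsC_unit (c : K) : (fpsC c \is a GRing.unit) = (c != 0).
Proof. by rewrite fps_unitE. Qed.

Lemma fpscoefXM f n :
  fpscoef (fpsX K * f) n = if n is m.+1 then fpscoef f m else 0.
Proof.
case: n => [|n] /=; first by rewrite big_ord1 mul0r.
rewrite 2!big_ord_recl /= mul0r add0r mul1r subn1 big1 ?addr0 // => i _.
by rewrite mul0r.
Qed.

Lemma fpscoefXnM f k n :
  fpscoef (fpsX K ^+ k * f) n = if (n < k)%N then 0 else fpscoef f (n - k).
Proof.
elim: k n => [|k IHk] n; first by rewrite mul1r subn0.
by rewrite exprS -mulrA fpscoefXM; case: n => // n; rewrite IHk.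
Qed.

Lemma fpsX_neq0 : fpsX K != 0.
Proof.
by apply/eqP => /(congr1 (fun h => fpscoef h 1))/eqP; rewrite /= oner_eq0.
Qed.

Lemma fps_factor f : f != 0 ->
  exists n, exists2 u, u \is a GRing.unit & f = fpsX K ^+ n * u.
Proof.
move=> /fps_lowest[n fn fmin]; exists n.
exists (Fps (fun i => fpscoef f (n + i))); first by rewrite fps_unitE /= addn0.
apply: fpsP => m; rewrite fpscoefXnM; case: ltnP => [/fmin //|lenm].
by rewrite /= subnKC.
Qed.

Lemma fpsX_exp_dvd (m n : nat) (u w : fps K) : u \is a GRing.unit ->
  fpsX K ^+ n * u = fpsX K ^+ m * w -> (m <= n)%N.
Proof.
rewrite fps_unitE leqNgt => u0 /(congr1 (fun h => fpscoef h n)).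
rewrite !fpscoefXnM ltnn subnn => eu; apply/negP => ltnm.
by rewrite eu ltnm eqxx in u0.
Qed.

(** K[[t]] is a valuation ring. *)
Lemma fps_dvd_total f g : (exists q, g = f * q) \/ (exists q, f = g * q).
Proof.
have [->|/fps_factor[m [u uU ->]]] := eqVneq f 0.
  by right; exists 0; rewrite mulr0.
have [->|/fps_factor[n [w wU ->]]] := eqVneq g 0.
  by left; exists 0; rewrite mulr0.
have [lemn|/ltnW lenm] := leqP m n; [left|right].
  exists (fpsX K ^+ (n - m) * (w / u)).
  by rewrite -{1}(subnKC lemn) exprD -!mulrA (mulrCA u) (mulrCA u) divrr // mulr1.
exists (fpsX K ^+ (m - n) * (u / w)).
by rewrite -{1}(subnKC lenm) exprD -!mulrA (mulrCA w) (mulrCA w) divrr // mulr1.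
Qed.

(** Among finitely many series, one of least valuation divides the others: this
    is the pivot of the elimination below. *)
Lemma fps_min_dvd (I : finType) (a : I -> fps K) : I ->
  exists i, forall j, exists q, a j = a i * q.
Proof.
move=> i0; suff [i iP] : exists i, forall j, j \in enum I -> exists q, a j = a i * q.
  by exists i => j; apply: iP; rewrite mem_enum.
elim: (enum I) => [|k s [i iP]]; first by exists i0.
have [[q akq]|[q aiq]] := fps_dvd_total (a i) (a k).
  by exists i => j; rewrite inE => /predU1P[->|/iP //]; exists q.
exists k => j; rewrite inE => /predU1P[->|/iP[p ->]].
  by exists 1; rewrite mulr1.
by exists (q * p); rewrite aiq mulrA.
Qed.

End PowerSeries.

(** * Triangular forms over K[[t]] *)

(** Gaussian elimination without division: an entry of the first row which
    divides the whole row is moved to the corner, and clears that row. *)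
Lemma fps_column_reduction {K : fieldType} {n} (A : 'M[fps K]_n) :
  exists2 Q, Q \in unitmx & is_trig_mx (A *m Q).
Proof.
elim: n A => [|n IHn] A.
  by exists 1%:M; rewrite ?unitmx1 //; apply/is_trig_mxP => -[].
have [j0 j0P] := fps_min_dvd (A ord0) ord0.
pose A1 : 'M_(1 + n) := xcol ord0 j0 A.
have [q qP] : exists q : 'rV_n, ursubmx A1 = ulsubmx A1 *m q.
  have A1_00 : ulsubmx A1 0 0 = A ord0 j0.
    rewrite !mxE (_ : lshift n (0 : 'I_1) = ord0 :> 'I_n.+1) ?tpermL //.
    exact: val_inj.
  have /fin_all_exists[q qP] j : exists x, ursubmx A1 0 j = A ord0 j0 * x.
    have [x xP] := j0P (tperm ord0 j0 (rshift 1 j)); exists x.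
    by rewrite !mxE -xP; congr (A _ _); apply: val_inj.
  exists (\row_j q j); apply/matrixP => i j.
  by rewrite ord1 qP mxE big_ord1 A1_00 mxE.
have [Q Qu Qt] := IHn (drsubmx A1 - dlsubmx A1 *m q).
pose Q1 : 'M_(1 + n) := block_mx 1%:M (- q) 0 1%:M.
pose Q2 : 'M_(1 + n) := block_mx 1%:M 0 0 Q.
have Q1u : Q1 \in unitmx by rewrite unitmxE det_ublock !det1 mulr1 unitr1.
have Q2u : Q2 \in unitmx by rewrite unitmxE det_ublock det1 mul1r -unitmxE.
exists (tperm_mx ord0 j0 *m (Q1 *m Q2)).
  by rewrite !unitmx_mul unitmx_perm Q1u Q2u.
rewrite mulmxA -xcolE -/A1.
(* Restated with dimensions 1 + n instead of n.+1, where blocks make sense. *)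
suff: is_trig_mx (A1 *m (Q1 *m Q2)) by [].
rewrite -[A1]submxK mulmxA !mulmx_block qP.
rewrite !mulmx1 !mulmx0 !addr0 mulmxN addNr mulmxN !mul0mx !add0r.
by rewrite is_trig_block_mx // eqxx mx11_is_trig addrC.
Qed.

(** The permutation sends i to the number of k that come before it. *)
Lemma rank_perm {n} (f : 'I_n -> nat) : injective f ->
  exists s : 'S_n, forall i j, (f j < f i)%N -> (s j < s i)%N.
Proof.
move=> f_inj; pose below i := [set k | (f k < f i)%N].
have lt_below i j : (f j < f i)%N -> (#|below j| < #|below i|)%N.
  move=> ltji; apply/proper_card/properP; split.
    by apply/fintype.subsetP => k; rewrite !inE => /ltn_trans; apply.
  by exists j; rewrite !inE ?ltnn.
have below_n i : (#|below i| < n)%N.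
  rewrite -[X in (_ < X)%N]card_ord -cardsT; apply/proper_card/properP.
  by split; [exact: finset.subsetT | exists i; rewrite !inE ?ltnn].
pose g i := Ordinal (below_n i).
have g_inj : injective g.
  move=> i j /(congr1 val)/= eqij; apply: f_inj; apply/eqP.
  by case: ltngtP => // /lt_below; rewrite eqij ltnn.
by exists (perm g_inj) => i j /lt_below; rewrite !permE.
Qed.

(** The order f is arbitrary since conjugating by the permutation that sorts 'I_n
    by f reduces to the usual order; transposing turns columns into rows. *)
Lemma fps_row_reduction {K : fieldType} {n} (f : 'I_n -> nat) (A : 'M[fps K]_n) :
  injective f ->
  exists P, [/\ P \in unitmx,
    forall i j, (f j < f i)%N -> (P *m A) i j = 0 &
    \det (P *m A) = \prod_i (P *m A) i i].
Proof.
move=> /rank_perm[s sP].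
have [Q Qu /is_trig_mxP Qt] :=
  fps_column_reduction (row_perm s^-1%g (col_perm s^-1%g A))^T.
pose P := row_perm s (col_perm s Q^T).
have PE : P *m A =
    row_perm s (col_perm s (Q^T *m row_perm s^-1%g (col_perm s^-1%g A))).
  rewrite /P !row_permE !col_permE invgK !mulmxA.
  by rewrite -!mulmxA -!perm_mxM mulgV perm_mx1 mulmx1.
have Peq i j : (P *m A) i j =
    ((row_perm s^-1%g (col_perm s^-1%g A))^T *m Q) (s j) (s i).
  by rewrite PE [LHS]mxE [LHS]mxE -[Q^T *m _]trmxK trmx_mul trmxK mxE.
exists P; split.
- by rewrite /P row_permE col_permE !unitmx_mul !unitmx_perm unitmx_tr Qu.
- by move=> i j /sP/Qt; rewrite Peq.
rewrite (eq_bigr _ (fun i _ => Peq i i)).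
set M := (_ *m Q).
transitivity (\prod_i M i i); last exact: (reindex_inj (@perm_inj _ s)).
rewrite -det_trig; last exact/is_trig_mxP.
rewrite PE row_permE col_permE det_mulmx (det_mulmx _ (perm_mx _)) !det_perm.
rewrite odd_permV mulrCA -signr_addb addbb mulr1 -det_tr.
by rewrite trmx_mul trmxK.
Qed.

(** Both orders put A on top, and they are opposite to each other on A, which is
    what the last clause expresses. *)
Lemma opposite_orders {N} (A : {pred 'I_N}) : exists f0 f1 : 'I_N -> nat,
  [/\ injective f0, injective f1,
      forall i j, i \in A -> (f0 i <= f0 j)%N -> j \in A,
      forall i j, i \in A -> (f1 i <= f1 j)%N -> j \in A &
      forall i j, i \in A -> (f0 i <= f0 j)%N -> (f1 i <= f1 j)%N -> i = j].
Proof.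
exists (fun i => if i \in A then (N + (N - i))%N else i).
exists (fun i => if i \in A then (N + i)%N else i).
split=> i j; have := ltn_ord i; have := ltn_ord j;
  case: (i \in A); case: (j \in A) => //= ltj lti;
  by [move=> e; apply: val_inj => /=; lia | move=> _ le; lia
     | move=> _ le0 le1; apply: val_inj => /=; lia].
Qed.

(** * Tensors that are diagonal on a set *)

Lemma tensor_act_mul {L : fieldType} {d} {T : finType} (P g : 'I_d -> 'M[L]_#|T|)
    (v : tensor L (fun _ : 'I_d => T)) :
  tensor_act (fun l => P l *m g l) v = tensor_act P (tensor_act g v).
Proof.
apply/ffunP => x; rewrite !ffunE.
transitivity (\sum_(y : {ffun 'I_d -> T}) \sum_(z : {ffun 'I_d -> T})
  (\prod_l (P l (enum_rank (x l)) (enum_rank (z l)) *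
            g l (enum_rank (z l)) (enum_rank (y l)))) * v y).
  apply: eq_bigr => y _; rewrite -mulr_suml; congr (_ * _).
  rewrite -(bigA_distr_bigA (fun l t => P l (enum_rank (x l)) (enum_rank t) *
            g l (enum_rank t) (enum_rank (y l)))).
  apply: eq_bigr => l _; rewrite mxE.
  by rewrite (reindex enum_rank) //; apply: onW_bij; apply: enum_rank_bij.
rewrite exchange_big; apply: eq_bigr => z _; rewrite ffunE mulr_sumr.
by apply: eq_bigr => y _; rewrite big_split mulrA.
Qed.

(** The order on the first factor is opposite on S to the common order on the
    others. In the expansion of the entry of g.v at (a, ..., a), triangularity
    keeps only the y whose coordinates are all at least a in the respective
    orders; these lie in S, and v y <> 0 makes them equal to one b, which is at
    least a in two opposite orders. *)
Lemma diagonal_det_dvd {K : fieldType} {d} {T : finType}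
    (v : tensor K (fun _ : 'I_d.+2 => T)) (S : {set T})
    (g : 'I_d.+2 -> 'M[fps K]_#|T|) (m : nat)
    (w : {dffun forall i : 'I_d.+2, T} -> fps K) :
    (forall x : {dffun forall i : 'I_d.+2, T}, (forall i, x i \in S) ->
       (v x != 0) = [forall i, x i == x ord0]) ->
    (forall x, tensor_act (fun l => map_mx (@tofrac (fps K)) (g l))
                 (tensor_laurent v) x = tofrac (fpsX K ^+ m * w x)) ->
  exists w', \prod_l \det (g l) = fpsX K ^+ (m * #|S|) * w'.
Proof.
move=> vS gv.
have [f0 [f1 [f0_inj f1_inj f0_S f1_S f_ge]]] :=
  opposite_orders [pred i : 'I_#|T| | enum_val i \in S].
pose f (l : 'I_d.+2) := if l == ord0 then f0 else f1.
have f_inj l : injective (f l) by rewrite /f; case: ifP.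
have f_S l a b : a \in S -> (f l (enum_rank a) <= f l (enum_rank b))%N -> b \in S.
  move=> aS; rewrite /f; case: ifP => _.
    by move/f0_S; rewrite !inE !enum_rankK; apply.
  by move/f1_S; rewrite !inE !enum_rankK; apply.
have [P PP] := fin_all_exists (fun l => fps_row_reduction (g l) (f_inj l)).
pose G l := P l *m g l.
(* Row operations have entries in K[[t]], so they keep the factor t^m. *)
have GvX x : exists q, tensor_act (fun l => map_mx (@tofrac (fps K)) (G l))
    (tensor_laurent v) x = tofrac (fpsX K ^+ m * q).
  exists (\sum_(z : {dffun forall i : 'I_d.+2, T})
    (\prod_l P l (enum_rank (x l)) (enum_rank (z l))) * w z).
  rewrite (_ : (fun l => map_mx _ (G l)) = fun l =>
    map_mx (@tofrac _) (P l) *m map_mx (@tofrac _) (g l)); last first.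
    by apply: funext => l; rewrite map_mxM.
  rewrite tensor_act_mul ffunE mulr_sumr rmorph_sum; apply: eq_bigr => z _ /=.
  rewrite gv [in RHS]mulrCA [in RHS]rmorphM rmorph_prod; congr (_ * _).
  by apply: eq_bigr => l _; rewrite mxE.
have diag a : a \in S ->
    exists q, \prod_l G l (enum_rank a) (enum_rank a) = fpsX K ^+ m * q.
  move=> aS; pose c : {dffun forall i : 'I_d.+2, T} := [ffun => a].
  have vc : v c != 0.
    by rewrite vS => [|i]; [apply/forallP => i|]; rewrite !ffunE.
  have vcU : fpsC (v c) \is a GRing.unit by rewrite fpsC_unit.
  have [q qP] := GvX c; exists (q / fpsC (v c)).
  apply: (mulIr vcU); rewrite mulrA divrK //.
  apply/eqP; rewrite -tofrac_eq -qP ffunE (bigD1 c) //= [X in _ == _ + X]big1 ?addr0.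
    rewrite ffunE tofracM rmorph_prod; apply/eqP; congr (_ * _).
    by apply: eq_bigr => l _; rewrite [in RHS]mxE /c ffunE.
  move=> y yc; apply/eqP; rewrite mulf_eq0 ffunE tofrac_eq0.
  apply: contraNT yc; rewrite negb_or => /andP[/prodf_neq0 Gy vy].
  have le l : (f l (enum_rank a) <= f l (enum_rank (y l)))%N.
    have [_ Gz _] := PP l.
    rewrite leqNgt; apply/negP => /Gz.
    by have := Gy l isT; rewrite mxE tofrac_eq0 /c ffunE => /eqP.
  have yS l : y l \in S by exact: f_S aS (le l).
  have {}vy : v y != 0.
    by apply: contraNneq vy => ->; rewrite rmorph0.
  rewrite vS // in vy; move/forallP: vy => yE.
  have := le (lift ord0 ord0); rewrite (eqP (yE _)) => le1.
  have ya : a = y ord0.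
    apply/enum_rank_inj/f_ge; rewrite ?inE ?enum_rankK //; exact: le ord0.
  by apply/eqP/ffunP => l; rewrite ffunE (eqP (yE l)) -ya.
have /fin_all_exists[q qP] a : exists q, a \in S ->
    \prod_l G l (enum_rank a) (enum_rank a) = fpsX K ^+ m * q.
  by case: (boolP (a \in S)) => [/diag[q qE]|_]; [exists q|exists 0].
pose u := \prod_l \det (P l).
have uU : u \is a GRing.unit.
  by apply: rpred_prod => l _; case: (PP l); rewrite unitmxE.
(* The determinants are grouped by diagonal position instead of by factor;
   the positions outside S only contribute a power series. *)
pose rest := \prod_(a | a \notin S) \prod_l G l (enum_rank a) (enum_rank a).
have detG : \prod_l \det (G l) =
    fpsX K ^+ (m * #|S|) * ((\prod_(a in S) q a) * rest).
  transitivity (\prod_(a : T) \prod_l G l (enum_rank a) (enum_rank a)).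
    rewrite exchange_big; apply: eq_bigr => l _; case: (PP l) => _ _ ->.
    by rewrite (reindex enum_rank) //; apply: onW_bij; apply: enum_rank_bij.
  rewrite (bigID (mem S)) /= mulrA; congr (_ * _).
  by rewrite (eq_bigr _ qP) big_split prodr_const exprM.
exists (u^-1 * ((\prod_(a in S) q a) * rest)).
rewrite mulrCA -detG (eq_bigr (fun l => \det (P l) * \det (g l))); last first.
  by move=> l _; rewrite det_mulmx.
by rewrite big_split /= mulKr.
Qed.

(** * The lower bound *)

Lemma valt_tofrac {R : realType} {K : fieldType} (n : nat) (u : fps K) :
  u \is a GRing.unit ->
  valt R (fun _ : unit => tofrac (fpsX K ^+ n * u)) = n%:R%:E.
Proof.
move=> uU; apply/le_anti/andP; split.
  apply: ge_ereal_sup => _ [m [w wP] <-]; rewrite lee_fin.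
  case: m wP => m wP; last by rewrite (le_trans _ (ler0n _ _)) // lerz0.
  have := wP tt; rewrite -exprnP -tofracXn -tofracM => /eqP.
  by rewrite tofrac_eq ler_nat => /eqP/fpsX_exp_dvd; apply.
apply: ereal_sup_ubound; exists n%:Z => //; exists (fun=> u) => _.
by rewrite tofracM tofracXn.
Qed.

Lemma valt_ge1 {R : realType} {K : fieldType} {X : Type} (v : X -> laurent K)
    (w : X -> fps K) :
  (forall x, v x = tofrac (fpsX K * w x)) -> (1 <= valt R v)%E.
Proof.
move=> vw; apply: ereal_sup_ubound; exists 1 => //; exists w => x.
by rewrite vw tofracM expr1z.
Qed.

(** The bound on the valuation of g.v is obtained in the form val <= D / |S|, with
    D the numerator; so that valuation is finite as soon as S is not empty. *)
Lemma diagonal_le_G_stable_rank {R : realType} {K : fieldType} {d} {T : finType}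
    (v : tensor K (fun _ : 'I_d.+2 => T)) (S : {set T}) :
    (forall x : {dffun forall i : 'I_d.+2, T}, (forall i, x i \in S) ->
       (v x != 0) = [forall i, x i == x ord0]) ->
  (#|S|%:R%:E <= G_stable_rank R v)%E.
Proof.
move=> vS; apply: le_ereal_inf_tmp => _ [g [gU den_gt0 ->]].
have detE l : exists n : nat, exists2 u, u \is a GRing.unit &
    \det (g l) = fpsX K ^+ n * u.
  apply: fps_factor; rewrite -tofrac_eq0 -det_map_mx -unitfE -unitmxE.
  exact: gU.
have {detE}[n /fin_all_exists2[u uU detE]] := fin_all_exists detE.
pose D := (\sum_l n l)%N.
rewrite (eq_bigr (fun l => (n l)%:R%:E)) => [|l _]; last first.
  by rewrite det_map_mx detE valt_tofrac.
rewrite sumEFin -natr_sum -/D.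
set den := valt R _ in den_gt0 *.
have [S0|S_gt0] := posnP #|S|.
  by rewrite S0 mule_ge0 ?lee_fin ?inve_ge0 ?ler0n // ltW.
have den_le : (den <= (D%:R / #|S|%:R)%:E)%E.
  apply: ge_ereal_sup => _ [m [w gv] <-]; rewrite lee_fin.
  (* A negative m is harmless, as the right-hand side is nonnegative. *)
  case: m gv => m gv; last first.
    by rewrite (le_trans _ (divr_ge0 (ler0n _ _) (ler0n _ _))) // lerz0.
  rewrite ler_pdivlMr ?ltr0n // -pmulrn -natrM ler_nat.
  have [|w' detw'] := diagonal_det_dvd (g := g) (m := m) (w := w) vS.
    by move=> x; rewrite gv tofracM tofracXn.
  have prodU : \prod_l u l \is a GRing.unit by apply: rpred_prod.
  apply: (fpsX_exp_dvd (w := w') prodU).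
  rewrite -detw' (eq_bigr _ (fun l _ => detE l)).
  by rewrite big_split /= prodrXr.
move: den den_gt0 den_le => [r| |] //; rewrite lte_fin lee_fin => r_gt0.
rewrite ler_pdivlMr ?ltr0n // mulrC => le_rD.
by rewrite inver gt_eqF // lee_fin ler_pdivlMr.
Qed.

(** * The upper bound *)

(** A sum over all index tuples is a sum over the lines of direction i, each
    line being represented by its point with i-th coordinate a. *)
Lemma sum_slices {R : nmodType} {d} {I : 'I_d -> finType} (i : 'I_d) (a : I i)
    (F : {dffun forall j, I j} -> R) :
  \sum_y F y = \sum_(z : {dffun forall j, I j} | z i == a)
    \sum_(b : I i) F [ffun j => dfwith (fun j => z j) b j].
Proof.
pose put (y : {dffun forall j, I j}) (b : I i) : {dffun forall j, I j} :=
  [ffun j => dfwith (fun j => y j) b j].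
have putE y b : put y b i = b by rewrite ffunE dfwith_in.
have put_id y : put y (y i) = y.
  by apply/ffunP => j; rewrite ffunE; case: dfwithP.
have putK y b c : put (put y b) c = put y c.
  apply/ffunP => j; rewrite !ffunE; case: dfwithP => [|k ik].
    by rewrite dfwith_in.
  by rewrite ffunE !dfwith_out.
rewrite (partition_big (fun y => put y a) (fun z => z i == a)) => [|y _]; last first.
  by rewrite putE.
apply: eq_bigr => z /eqP zi; rewrite (reindex (put z)) /=.
  by apply: eq_bigl => b; rewrite putK -zi put_id eqxx.
exists (fun y : {dffun forall j, I j} => y i) => [b _|y /eqP yz]; first exact: putE.
by rewrite -yz putK put_id.
Qed.

(** The image of a slice s = W * s' is the slice (g_i W) * (g s'), so that a
    common factor t of the coordinates of g_i W divides it. *)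
Lemma tensor_act_slice {K : fieldType} {d} {I : 'I_d -> finType} (i : 'I_d)
    (g : forall j, 'M[fps K]_#|I j|) (W : I i -> K) (s s' : tensor K I) (t : fps K) :
    (forall x y : {dffun forall j, I j},
       (forall j, j != i -> x j = y j) -> s' x = s' y) ->
    (forall x : {dffun forall j, I j}, s x = W (x i) * s' x) ->
    (forall a, exists q,
       \sum_b g i (enum_rank a) (enum_rank b) * fpsC (W b) = t * q) ->
  forall x : {dffun forall j, I j}, exists q,
    tensor_act (fun j => map_mx (@tofrac (fps K)) (g j)) (tensor_laurent s) x
      = tofrac (t * q).
Proof.
move=> s'P sE gW x; have [q qE] := gW (x i).
exists (\sum_(z : {dffun forall j, I j} | z i == x i)
  (\prod_(j | j != i) g j (enum_rank (x j)) (enum_rank (z j))) * fpsC (s' z) * q).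
rewrite ffunE (sum_slices (x i)) mulr_sumr rmorph_sum; apply: eq_bigr => z _.
rewrite /= mulrCA -qE mulr_sumr rmorph_sum; apply: eq_bigr => b _.
set y : {dffun forall j, I j} := [ffun j => _].
have yi : y i = b by rewrite ffunE dfwith_in.
have yj j : j != i -> y j = z j by move=> ji; rewrite ffunE dfwith_out // eq_sym.
rewrite (bigD1 i) //= yi [tensor_laurent _ _]ffunE sE yi (s'P y z yj).
rewrite !rmorphM rmorph_prod mxE /=.
rewrite [in LHS](eq_bigr (fun j =>
  tofrac (g j (enum_rank (x j)) (enum_rank (z j))))).
  by rewrite mulrACA mulrC.
by move=> j ji; rewrite mxE yj.
Qed.

(** The columns of B i are the vectors of the slices of direction i. Gaussian
    elimination gives an invertible A i over K such that A i *m B i vanishes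
    below its first \rank (B i) rows, and g i multiplies these rows by t. *)
Lemma G_stable_rank_le_slices {R : realType} {K : fieldType} {d}
    {I : 'I_d -> finType} (v : tensor K I) (r : nat) :
  slice_decomp v r -> (G_stable_rank R v <= r%:R%:E)%E.
Proof.
move=> [s [s1 vE]].
have slices k : exists (i : 'I_d) (W : forall j, I j -> K) (s' : tensor K I),
    (forall x y : {dffun forall j, I j},
       (forall j, j != i -> x j = y j) -> s' x = s' y) /\
    (forall x : {dffun forall j, I j}, s k x = W i (x i) * s' x).
  have [_ [i [w [s' [s'P sE]]]]] := s1 k.
  by exists i, (dfwith (fun j (_ : I j) => 0) w), s'; rewrite dfwith_in.
(* W k extends the vector of the k-th slice by 0 to all the factors, so that it
   can be evaluated on the i-th factor without transport along dir k = i. *)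
have {slices}[dir /fin_all_exists[W /fin_all_exists[s' sP]]] :=
  fin_all_exists slices.
pose B i : 'M[K]_(#|I i|, #|[pred k | dir k == i]|) :=
  \matrix_(a, c) W (enum_val c) i (enum_val a).
pose A i := invmx (col_ebase (B i)).
have AU i : A i \in unitmx by rewrite unitmx_inv col_ebase_unit.
have AB i : A i *m B i = pid_mx (\rank (B i)) *m row_ebase (B i).
  by rewrite -[in LHS](mulmx_ebase (B i)) -mulmxA mulKmx ?col_ebase_unit.
pose g i : 'M[fps K]_#|I i| :=
  diag_mx (\row_a (if (a < \rank (B i))%N then fpsX K else 1))
    *m map_mx (@fpsC K) (A i).
have detg i : \det (g i) = fpsX K ^+ \rank (B i) * fpsC (\det (A i)).
  rewrite det_mulmx det_diag det_map_mx; congr (_ * _).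
  under eq_bigr do rewrite mxE.
  rewrite -big_mkcond (big_ord_narrow (rank_leq_row (B i))).
  by rewrite prodr_const card_ord.
have detAU i : fpsC (\det (A i)) \is a GRing.unit.
  by rewrite fpsC_unit -unitfE -unitmxE AU.
have rank_sum : (\sum_i \rank (B i) <= r)%N.
  apply: (@leq_trans (\sum_i #|[pred k | dir k == i]|)).
    by apply: leq_sum => i _; apply: rank_leq_col.
  rewrite -[X in (_ <= X)%N]card_ord -sum1_card (partition_big dir xpredT) //=.
  apply: eq_leq; apply: eq_bigr => i _; rewrite -sum1_card.
  by apply: eq_bigl => k; rewrite !inE.
have gW k a : exists q, \sum_b g (dir k) (enum_rank a) (enum_rank b) *
    fpsC (W k (dir k) b) = fpsX K * q.
  set i := dir k; have ki : k \in [pred k | dir k == i] by rewrite inE.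
  pose c := enum_rank_in ki k.
  have -> : \sum_b g i (enum_rank a) (enum_rank b) * fpsC (W k i b) =
      (g i *m map_mx (@fpsC K) (B i)) (enum_rank a) c.
    rewrite mxE [RHS](reindex enum_rank) /=; last exact/onW_bij/enum_rank_bij.
    by apply: eq_bigr => b _; rewrite !mxE enum_rankK enum_rankK_in.
  rewrite -mulmxA -map_mxM AB mul_diag_mx !mxE.
  case: ltnP => [_|le_rank_a]; first by eexists.
  exists 0; rewrite mul1r mulr0 big1 ?rmorph0 // => j _.
  by rewrite mxE (leq_gtF le_rank_a) andbF mul0r.
pose h i := map_mx (@tofrac (fps K)) (g i).
have den_ge1 : (1 <= valt R (tensor_act h (tensor_laurent v)))%E.
  have actX x : exists q, tensor_act h (tensor_laurent v) x =
      tofrac (fpsX K * q).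
    have [q qE] := fin_all_exists (fun k =>
      tensor_act_slice (proj1 (sP k)) (proj2 (sP k)) (gW k) x).
    exists (\sum_k q k); rewrite mulr_sumr rmorph_sum.
    rewrite -(eq_bigr _ (fun k _ => qE k)) ffunE.
    under [RHS]eq_bigr do rewrite ffunE.
    rewrite exchange_big; apply: eq_bigr => y _ /=.
    rewrite -mulr_sumr ffunE vE sum_ffunE !rmorph_sum; congr (_ * _).
    by apply: eq_bigr => k _; rewrite ffunE.
  have [q qE] := fin_all_exists actX.
  exact: valt_ge1 qE.
apply: (@le_trans _ _ ((\sum_i valt R (fun _ : unit => \det (h i))) /
    valt R (tensor_act h (tensor_laurent v)))%E).
  apply: ereal_inf_lbound; exists g; split => // [i|].
    rewrite unitmxE unitfE det_map_mx detg tofrac_eq0 mulf_neq0 //.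
      by rewrite expf_neq0 // fpsX_neq0.
    by apply: contraTneq (detAU i) => ->; rewrite unitr0.
  exact: lt_le_trans den_ge1.
rewrite (eq_bigr (fun i => (\rank (B i))%:R%:E)) => [|i _]; last first.
  by rewrite det_map_mx detg valt_tofrac.
rewrite sumEFin -natr_sum; move: (valt R _) den_ge1 => [x| |] //; last first.
  by rewrite mule0 lee_fin.
rewrite lee_fin => x_ge1; have x_gt0 : 0 < x by apply: lt_le_trans x_ge1.
rewrite inver gt_eqF // lee_fin ler_pdivrMr //.
apply: (@le_trans _ _ (r%:R)); first by rewrite ler_nat.
by rewrite ler_peMr.
Qed.

(** * The tensor u and progressions *)

Lemma zero_sum_tensorE (y : {dffun forall i : 'I_3, 'Z_3}) :
  zero_sum_tensor y =
    (y ord0 + y (lift ord0 ord0) + y (lift ord0 (lift ord0 ord0)) == 0)%:R.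
Proof.
move y0E : (y ord0) => y0; move y1E : (y (lift ord0 ord0)) => y1.
move y2E : (y (lift ord0 (lift ord0 ord0))) => y2.
have pureE i j k :
    pure_tensor (tnth [tuple basis_vec i; basis_vec j; basis_vec k]) y =
      ((y0 == i) && ((y1 == j) && (y2 == k)))%:R.
  rewrite ffunE !big_ord_recl big_ord0 mulr1 /tnth /= /basis_vec y0E y1E y2E.
  by rewrite -!natrM !mulnb.
transitivity (\sum_i \sum_j \sum_(k | i + j + k == 0)
    ((y0 == i) && ((y1 == j) && (y2 == k)))%:R : 'F_3).
  rewrite /zero_sum_tensor sum_ffunE; apply: eq_bigr => i _.
  rewrite sum_ffunE; apply: eq_bigr => j _.
  by rewrite sum_ffunE; apply: eq_bigr => k _; rewrite pureE.
rewrite (bigD1 y0) //= [X in _ + X]big1 ?addr0 => [|i ne_i]; last first.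
  by rewrite big1 // => j _; rewrite big1 // => k _; rewrite eq_sym (negPf ne_i).
rewrite (bigD1 y1) //= [X in _ + X]big1 ?addr0 => [|j ne_j]; last first.
  by rewrite big1 // => k _; rewrite eqxx eq_sym (negPf ne_j).
rewrite big_mkcond (bigD1 y2) //= [X in _ + X]big1 ?addr0 => [|k ne_k]; last first.
  by rewrite !eqxx (eq_sym y2) (negPf ne_k) if_same.
by rewrite !eqxx; case: ifP.
Qed.

Lemma triple_eq0 {n} (x : 'rV['F_3]_n) : x + x + x = 0.
Proof.
apply/rowP => l; rewrite !mxE; move: (x 0 l) => c; apply: val_inj.
by case: c => -[|[|[|]]].
Qed.

(** Since 3 b = 0, the equation a + b + c = 0 is a + c = 2 b; if two of a, b, c
    coincide, it forces the third one to be equal to them. *)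
Lemma ap3_free_zero_sum {n} (S : {set 'rV['F_3]_n}) (a b c : 'rV['F_3]_n) :
  ap3_free S -> a \in S -> b \in S -> c \in S ->
  (a + b + c == 0) = (b == a) && (c == a).
Proof.
move=> S_free aS bS cS; apply/eqP/andP => [abc0|[/eqP-> /eqP->]]; last first.
  exact: triple_eq0.
have two (x y : 'rV['F_3]_n) : x + x + y = 0 -> y = x.
  by move=> xxy; apply: (addrI (x + x)); rewrite xxy triple_eq0.
have [ab|ab] := eqVneq a b; first by subst b; rewrite (two _ _ abc0) !eqxx.
have [bc|bc] := eqVneq b c.
  by subst c; case/eqP: ab; apply: two; rewrite addrC addrA.
have [ac|ac] := eqVneq a c.
  by subst c; case/eqP: ab; apply/esym/two; rewrite addrAC.
case/negP: S_free; apply/existsP; exists a; rewrite aS /=.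
apply/existsP; exists b; rewrite bS /=; apply/existsP; exists c; rewrite cS /=.
rewrite ab bc ac /=; apply/eqP/(addrI b).
by rewrite addrCA addrA abc0 mulr2n addrA triple_eq0.
Qed.

Lemma ap3_free_le_G_stable_rank {R : realType} {n} (S : {set 'rV['F_3]_n}) :
  ap3_free S -> (#|S|%:R%:E <= G_stable_rank R (vpow n zero_sum_tensor))%E.
Proof.
move=> S_free.
pose phi (x : 'rV['F_3]_n) : {ffun 'I_n -> 'Z_3} := [ffun l => x 0 l].
have phi_inj : injective phi.
  by move=> x y /ffunP xy; apply/rowP => l; have := xy l; rewrite !ffunE.
rewrite -(card_imset (mem S) phi_inj).
apply: (diagonal_le_G_stable_rank (d := 1)) => x xS.
have /imsetP[a aS xa] := xS ord0.
have /imsetP[b bS xb] := xS (lift ord0 ord0).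
have /imsetP[c cS xc] := xS (lift ord0 (lift ord0 ord0)).
transitivity (a + b + c == 0).
  rewrite ffunE; apply/idP/eqP => [/prodf_neq0 nz|abc0].
    apply/rowP => l; have := nz l isT.
    rewrite zero_sum_tensorE !ffunE xa xb xc !ffunE.
    have of_bool (e : bool) : e%:R != 0 :> 'F_3 -> e by case: e.
    by rewrite !mxE => /of_bool/eqP.
  apply/prodf_neq0 => l _; rewrite zero_sum_tensorE !ffunE xa xb xc !ffunE.
  by have /rowP/(_ l) := abc0; rewrite !mxE => ->.
rewrite (ap3_free_zero_sum S_free) //.
apply/andP/forallP => [[/eqP ba /eqP ca] i|xE].
  by subst b c; case: (unliftP ord0 i) => [j|] -> //;
    case: (unliftP ord0 j) => [k|] ->; rewrite ?ord1 ?xb ?xc xa.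
have := xE (lift ord0 ord0); have := xE (lift ord0 (lift ord0 ord0)).
by rewrite xa xb xc !(inj_eq phi_inj).
Qed.

Local Open Scope ereal_scope.

Unset Implicit Arguments.

Theorem mainTheorem1 (R : realType) (n : nat) (n_ge1 : (1 <= n)%N) :
  (r3 n)%:R%:E <= G_stable_rank R (vpow n zero_sum_tensor) /\
  G_stable_rank R (vpow n zero_sum_tensor) <=
    (slice_rank (vpow n zero_sum_tensor))%:R%:E.
Proof.
split.
  have set0_free : ap3_free (finset.set0 : {set 'rV['F_3]_n}).
    by apply/negP => /existsP[x]; rewrite inE.
  rewrite /r3 (bigop.bigmax_eq_arg finset.set0) //.
  by case: arg_maxnP => // S S_free _; apply: ap3_free_le_G_stable_rank.
apply: G_stable_rank_le_slices.
by rewrite /slice_rank; case: ex_minnP => r /asboolP.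
Qed.
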